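(* Let $n\ge 1$, $r\ge 2$ and $s\ge 0$ be integers and let $\mathcal{F}$ be a family of non-empty subsets of $[n]$ such that $s<|F|$ for every $F\in\mathcal{F}$. Then $$\chi(\mathrm{KG}^r(\mathcal{F},s))\ge \left\lceil\frac{\mathrm{ecd}^r(\mathcal{F},\lfloor s/2\rfloor)}{r-1}\right\rceil.$$
   Context: $\mathrm{KG}^r(\mathcal{F},s)$ is the $r$-uniform hypergraph whose vertex set is $\mathcal{F}$ and whose edges are all $r$-subsets $\{F_1,\dots,F_r\}$ of $\mathcal{F}$ with $|F_i\cap F_j|\le s$ for all $1\le i<j\le r$. $\chi$ denotes the chromatic number (minimum number of colors in a vertex coloring with no monochromatic edge). For $s'\ge 0$ and $A,B\subseteq[n]$, write $A\subseteq_{s'}B$ if there is a set $E$ with $|E|\le s'$ and $A\setminus E\subseteq B$. An equitable partition of a set $X$ into $r$ parts is a partition $X=X_1\cup\dots\cup X_r$ (parts possibly empty) with $||X_i|-|X_j||\le 1$ for all $i,j$. $\mathrm{ecd}^r(\mathcal{F},s')$ is the minimum size of a set $X_0\subseteq[n]$ such that there is an equitable partition $[n]\setminus X_0=X_1\cup\dots\cup X_r$ with no $F\in\mathcal{F}$ and $i\in\{1,\dots,r\}$ satisfying $F\subseteq_{s'}X_i$. *)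

(* Defs.v *)
From mathcomp Require Import all_boot all_order all_algebra.

Set Implicit Arguments.
Unset Strict Implicit.
Unset Printing Implicit Defensive.

(* A hypergraph on the vertex type V is given by its set of edges. *)
Definition monochromatic (V C : finType) (c : {ffun V -> C}) (e : {set V}) :
    bool :=
  [forall x in e, forall y in e, c x == c y].

Definition colorable (V : finType) (E : {set {set V}}) (k : nat) : bool :=
  [exists c : {ffun V -> 'I_k}, forall e in E, ~~ monochromatic c e].

(* If every edge has at least two vertices, #|V| colors suffice, so the
   minimum ranges over a nonempty set; see chromatic_number_spec. *)
Definition chromatic_number (V : finType) (E : {set {set V}}) : nat :=
  [arg min_(k < (ord_max : 'I_#|V|.+1) | colorable E k) (k : nat)].

Lemma chromatic_number_spec (V : finType) (E : {set {set V}}) :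
  (forall e, e \in E -> 1 < #|e|) ->
  colorable E (chromatic_number E) /\
  forall k, colorable E k -> chromatic_number E <= k.
Proof.
move=> E2; rewrite /chromatic_number.
case: arg_minnP => [|k Ek mink].
  apply/existsP; exists [ffun x => enum_rank x].
  apply/forall_inP => e /E2 /card_gt1P[x [y [xe ye nxy]]].
  apply/negP => /forall_inP/(_ x xe)/forall_inP/(_ y ye).
  by rewrite !ffunE (inj_eq enum_rank_inj) (negPf nxy).
split=> // m Em; have [le_m|lt_m] := leqP m #|V|.
  exact: (mink (Ordinal (le_m : m < #|V|.+1)) Em).
exact: leq_trans (leq_ord k) (ltnW lt_m).
Qed.

(* The edges of KG^r(F, s), whose vertices are the members of F. *)
Definition KG (n r : nat) (F : {set {set 'I_n}}) (s : nat) :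
    {set {set {A : {set 'I_n} | A \in F}}} :=
  [set e : {set {A : {set 'I_n} | A \in F}} | (#|e| == r) &&
    [forall A in e, forall B in e,
       (A != B) ==> (#|val A :&: val B| <= s)]].

Definition almost_subset (T : finType) (s : nat) (A B : {set T}) : bool :=
  [exists E : {set T}, (#|E| <= s) && (A :\: E \subset B)].

(* Parts are indexed by 'I_r, so that several of them may be empty. *)
Definition equitable_partition (T : finType) (r : nat)
    (X : {ffun 'I_r -> {set T}}) (D : {set T}) : bool :=
  [&& \bigcup_(i < r) X i == D,
      [forall i, forall j, (i != j) ==> [disjoint X i & X j]]
    & [forall i, forall j, #|X i| <= #|X j| + 1]].

Definition ecd_admissible (n r : nat) (F : {set {set 'I_n}}) (s : nat)
    (X0 : {set 'I_n}) : bool :=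
  [exists X : {ffun 'I_r -> {set 'I_n}}, equitable_partition X (~: X0) &&
    ~~ [exists A in F, exists i, almost_subset s A (X i)]].

(* If every member of F has more than s elements, X0 = [n] is admissible, so
   the minimum ranges over a nonempty set; see ecd_spec. *)
Definition ecd (n r : nat) (F : {set {set 'I_n}}) (s : nat) : nat :=
  #|[arg min_(X0 < [set: 'I_n] | ecd_admissible r F s X0) #|X0|]|.

Lemma ecd_spec (n r : nat) (F : {set {set 'I_n}}) (s : nat) :
  (forall A, A \in F -> s < #|A|) ->
  (exists2 X0, ecd_admissible r F s X0 & #|X0| = ecd r F s) /\
  forall X0, ecd_admissible r F s X0 -> ecd r F s <= #|X0|.
Proof.
move=> Fs; rewrite /ecd; case: arg_minnP => [|X0 adm minX0]; last first.
  by split=> //; exists X0.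
apply/existsP; exists [ffun=> set0]; apply/andP; split.
  apply/and3P; split.
  - by rewrite setCT big1 // => i _; rewrite ffunE.
  - apply/forallP=> i; apply/forallP=> j; apply/implyP=> _.
    by rewrite !ffunE -setI_eq0 set0I.
  - by apply/forallP=> i; apply/forallP=> j; rewrite !ffunE cards0.
apply/exists_inP=> -[A /Fs ltsA /existsP[i /existsP[E /andP[leE]]]].
rewrite ffunE subset0 setD_eq0 => /subset_leq_card leA.
by move: (leq_trans ltsA (leq_trans leA leE)); rewrite ltnn.
Qed.

(* Main.v *)
Require Import Defs.
From mathcomp Require Import all_boot all_order all_algebra.
From mathcomp Require Import ring zify.

(* Replacing every F in the family by the sets F \ E with |E| <= s/2 turns an
   equitable partition avoiding "F almost contained in X_i" into one avoiding
   plain containment, and pairwise disjoint shrunken sets come from members of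
   the family that meet in at most 2(s/2) <= s points; so it suffices to treat
   s = 0.  There r is reduced to its prime factors, as in Kriz's theorem: if a
   proper t-colouring of KG^(qr) is given, the sets N in which the family
   contains q disjoint sets of one colour inherit a proper t-colouring of KG^r.

   For r = p prime, a vector with entries in Z_p or empty describes p disjoint
   subsets of the ground set.  If the bound failed, one could label every
   nonzero vector X of length n by an element of Z_p, equivariantly, and by a
   rank in 1..n-1, so that rank is monotone and comparable vectors of equal rank
   have the same label: below the threshold the rank is the size of the largest
   equitable part of X, above it the rank is given by the largest colour k
   occurring in X and the number of parts of X that contain a set of colour k.
   Freeness of the action of Z_p on proper nonempty subsets of Z_p gives the
   label.  Such a labelling is an equivariant map to a free Z_p-complex of
   dimension n-2, which is impossible by the following explicit form of
   Dold's theorem: the standard cocycle on EZ_p of degree n-1, pulled back along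
   any equivariant labelling, evaluates to 1 on a fundamental chain of the
   order complex of the poset of nonzero vectors, while it vanishes on every
   flag in which two consecutive labels agree. *)

Set Implicit Arguments.
Unset Strict Implicit.
Unset Printing Implicit Defensive.

Import GRing.Theory Num.Theory.
Local Open Scope ring_scope.

(** * Cochains on lists *)

Section Cochains.
Variables (V : Type) (R : comNzRingType).
Implicit Types (f g : seq V -> R) (s : seq V).

(* The alternating sum of the values of f on s with one entry deleted. *)
Fixpoint cobd f s : R :=
  if s is x :: s' then f s' - cobd (fun u => f (x :: u)) s' else 0.

(* The homotopy between the identity and map a: the alternating sum over i of
   f (x_0, .., x_i, a x_i, .., a x_k). *)
Fixpoint prism (a : V -> V) f s : R :=
  if s is x :: s' then
    f (x :: a x :: map a s') - prism a (fun u => f (x :: u)) s'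
  else 0.

(** A point reaches the apex [e] in two moves: from [x] to [a x] by the prism, then from [a x] to
    [e]. In the poset used below, [e] is comparable with [a x] but need not be with [x]. *)
Definition cone (e : V) (a : V -> V) f s : R :=
  f (e :: map a s) - prism a f s.

Lemma cobdB f g s : cobd (fun u => f u - g u) s = cobd f s - cobd g s.
Proof.
by elim: s f g => [|x s IHs] f g /=; rewrite ?subrr // IHs; ring.
Qed.

Lemma cobdZ c f s : cobd (fun u => c * f u) s = c * cobd f s.
Proof. by elim: s f => [|x s IHs] f /=; rewrite ?mulr0 // IHs; ring. Qed.

Lemma cobd_sum (I : finType) (F : I -> seq V -> R) s :
  cobd (fun u => \sum_i F i u) s = \sum_i cobd (F i) s.
Proof.
elim: s F => [|x s IHs] F /=; first by rewrite big1.
by rewrite (IHs (fun i u => F i (x :: u))) sumrB.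
Qed.

Lemma prismB a f g s : prism a (fun u => f u - g u) s = prism a f s - prism a g s.
Proof.
by elim: s f g => [|x s IHs] f g /=; rewrite ?subrr // IHs; ring.
Qed.

Lemma prism_local a f g s :
  (forall i, (i < size s)%N ->
     f (take i.+1 s ++ map a (drop i s)) = g (take i.+1 s ++ map a (drop i s))) ->
  prism a f s = prism a g s.
Proof.
elim: s f g => //= x s IHs f g fg; congr (_ - _).
  by have := fg 0 isT; rewrite take0 drop0.
by apply: IHs => i lt_i; apply: fg i.+1 lt_i.
Qed.

End Cochains.

Lemma cobd_map (V W : Type) (R : comNzRingType) (l : V -> W) (f : seq W -> R) s :
  cobd (fun u => f (map l u)) s = cobd f (map l s).
Proof. by elim: s f => //= x s IHs f; rewrite (IHs (fun u => f (l x :: u))). Qed.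

Section Homotopy.
Variables (V : Type) (R : comNzRingType) (a : V -> V).
Implicit Types (f : seq V -> R).

Lemma prism_homotopy f s :
  cobd (prism a f) s + prism a (cobd f) s = f (map a s) - f s.
Proof.
elim: s f => [|x s IHs] f /=; first by rewrite addr0 subrr.
rewrite cobdB prismB (cobd_map a (fun u => f [:: x, a x & u])).
rewrite (canRL (addrK _) (IHs (fun u => f (x :: u)))) /=; ring.
Qed.

Lemma cone_homotopy e f s : cobd (cone e a f) s + cone e a (cobd f) s = f s.
Proof.
rewrite /cone cobdB (cobd_map a (fun u => f (e :: u))) /=.
rewrite (canRL (addrK _) (prism_homotopy f s)); ring.
Qed.

End Homotopy.

(** * Cocycles of the cyclic group *)

Section Labels.
Variable q : nat.
Local Notation Zp := 'I_q.+2.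
Implicit Types (g : Zp) (s : seq Zp).

Definition wrap g0 g1 : Zp := (g1 < g0)%N%:R.

(* Over the integers, q.+2 * carry is the coboundary of the lift of g1 - g0 to
   0..q.+1 (see val_subDwrap); this is why carry is translation invariant. *)
Definition carry g0 g1 g2 : Zp := wrap g1 g2 - wrap g0 g2 + wrap g0 g1.

(* The invariant cocycles theta are the cup products of copies of carry with
   1 or g1 - g0, according to parity; psi is chosen so that the coboundary of
   psi k is theta k.+1 and so that applying g - 1 (k even) or the norm (k odd)
   to psi k gives theta k. *)
Fixpoint psi k s : Zp :=
  match k, s with
  | 0, [:: g0] => g0
  | 1, [:: g0; g1] => wrap g0 g1
  | k'.+2, g0 :: g1 :: (g2 :: _) as s' => carry g0 g1 g2 * psi k' s'
  | _, _ => 0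
  end.

Fixpoint theta k s : Zp :=
  match k, s with
  | 0, [:: g0] => 1
  | 1, [:: g0; g1] => g1 - g0
  | k'.+2, g0 :: g1 :: (g2 :: _) as s' => carry g0 g1 g2 * theta k' s'
  | _, _ => 0
  end.

Lemma carry_cocycle g0 g1 g2 g3 :
  carry g1 g2 g3 - carry g0 g2 g3 + carry g0 g1 g3 - carry g0 g1 g2 = 0.
Proof. rewrite /carry; ring. Qed.

Lemma cobd_psi k s : size s = k.+2 -> cobd (@psi k) s = theta k.+1 s.
Proof.
have [m le_km] := ubnP k; elim: m k le_km s => // m IHm [|[|k]] lt_km s.
- by case: s => [|g0 [|g1 [|]]] //= _; ring.
- by case: s => [|g0 [|g1 [|g2 [|]]]] //= _; rewrite /carry; ring.
case: s => [|g0 [|g1 [|g2 [|g3 s]]]] // [sz_s].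
have lt_k : (k < m)%N by rewrite -ltnS ltnW.
have /= E := IHm k lt_k (g2 :: g3 :: s) (congr1 (fun x => x.+2) sz_s).
rewrite /= -/(psi k) (cobdZ _ (fun u => psi k (g2 :: g3 :: u))).
(* Leibniz rule: the coboundary falls either on [psi k] or on the carry, and [carry_cocycle] kills
   the second part. *)
transitivity (carry g0 g1 g2 * (psi k (g3 :: s) -
      (psi k (g2 :: s) - cobd (fun u => psi k [:: g2, g3 & u]) s)) +
    (carry g1 g2 g3 - carry g0 g2 g3 + carry g0 g1 g3 - carry g0 g1 g2) * psi k (g3 :: s)).
  ring.
by rewrite carry_cocycle E mul0r addr0.
Qed.

Lemma val_subDwrap g0 g1 :
  (val (g1 - g0)%R + val g0 = val g1 + q.+2 * (val g1 < val g0))%N.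
Proof.
have := ltn_ord g0; have := ltn_ord g1 => lt_g1 lt_g0 /=; rewrite modnDmr.
have [lt_g|le_g] := ltnP g1 g0.
  by rewrite modn_small; lia.
have -> : (g1 + (q.+2 - g0) = (g1 - g0) + q.+2)%N by lia.
by rewrite modnDr modn_small; lia.
Qed.

(** Summing [val_subDwrap] over all translates cancels the values and leaves [q.+2] times the number
    of wraps equal to [q.+2] times the lift of [g1 - g0]. *)
Lemma sum_wrap g0 g1 : \sum_g wrap (g0 + g) (g1 + g) = g1 - g0.
Proof.
rewrite (reindex_inj (addIr (- g0))) /=.
set d := g1 - g0.
have wE g : wrap (g0 + (g - g0)) (g1 + (g - g0)) = wrap g (d + g).
  by congr wrap; rewrite /d; ring.
under eq_bigr => g _ do rewrite wE.
have : (q.+2 * \sum_g (val (d + g)%R < val g) = q.+2 * d)%N.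
  apply: (@addnI (\sum_(g : Zp) val g)).
  rewrite {1}(reindex_inj (addrI d)) /= big_distrr -big_split /=.
  under eq_bigr => g _ do rewrite -(val_subDwrap g (d + g)) addrK.
  by rewrite big_split /= sum_nat_const card_ord addnC.
move/eqP; rewrite eqn_pmul2l // => /eqP sum_d.
rewrite /wrap -natr_sum -[RHS]natr_Zp; congr _%:R; exact: sum_d.
Qed.

Lemma carryD g0 g1 g2 h : carry (g0 + h) (g1 + h) (g2 + h) = carry g0 g1 g2.
Proof.
(* The computation moves to the integers because [q.+2] vanishes in [Zp] and cannot be cancelled
   there. *)
pose w (x y : Zp) : int := (y < x)%N%:Z.
pose cz x y z := w y z - w x z + w x y.
have carryE x y z : carry x y z = (cz x y z)%:~R.
  by rewrite /cz rmorphD rmorphB.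
have wE x y : q.+2%:Z * w x y = (val (y - x))%:Z + (val x)%:Z - (val y)%:Z.
  by have := val_subDwrap x y; rewrite /w /=; lia.
have czE x y z : q.+2%:Z * cz x y z =
    (val (z - y))%:Z - (val (z - x))%:Z + (val (y - x))%:Z.
  by rewrite /cz mulrDr mulrBr !wE; ring.
rewrite !carryE; congr (_%:~R).
have /mulfI : q.+2%:Z != 0 by [].
have subD x y : (x + h) - (y + h) = x - y by ring.
by apply; rewrite !czE !subD.
Qed.

(** The invariant factor [carry] comes out of both operators, so the claim descends in steps of two
    to degree 0 or to degree 1, which is [sum_wrap]. *)
Lemma nu_psi k s : size s = k.+1 ->
  (if odd k then \sum_g psi k [seq x + g | x <- s]
   else psi k [seq x + 1 | x <- s] - psi k s) = theta k s.
Proof.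
have [m le_km] := ubnP k; elim: m k le_km s => // m IHm [|[|k]] lt_km s.
- by case: s => [|g0 []] //= _; ring.
- by case: s => [|g0 [|g1 []]] //= _; rewrite sum_wrap.
case: s => [|g0 [|g1 [|g2 s]]] // [sz_s].
have lt_k : (k < m)%N by rewrite -ltnS ltnW.
have := IHm k lt_k (g2 :: s) (congr1 S sz_s).
rewrite /= negbK -/(psi k) -/(theta k) => <-.
case: odd; last by rewrite carryD mulrBr.
by rewrite big_distrr; apply: eq_bigr => g _; rewrite carryD.
Qed.

(** Two adjacent entries always lie in a common factor of the cup product, and every factor vanishes
    when they agree. *)
Lemma theta_repeat k s i : (i.+1 < size s)%N ->
  nth 0 s i = nth 0 s i.+1 -> theta k s = 0.
Proof.
have [m le_km] := ubnP k; elim: m k le_km s i => // m IHm [|[|k]] lt_km s i.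
- by case: s => [|g0 []].
- case: s => [|g0 [|g1 []]] //=; case: i => //= _ ->; exact: subrr.
case: s => [|g0 [|g1 [|g2 s]]] //=; rewrite -/(theta k).
case: i => [|[|i]] /= lt_i eq_i.
- by rewrite eq_i /carry /wrap ltnn subrr addr0 mul0r.
- by rewrite eq_i /carry /wrap ltnn sub0r addNr mul0r.
have lt_k : (k < m)%N by rewrite -ltnS ltnW.
by rewrite (IHm k lt_k (g2 :: s) i) ?mulr0.
Qed.
End Labels.

(** * A Tucker lemma for cyclic groups *)

Section Tucker.
Variables q n : nat.
Local Notation Zp := 'I_q.+2.
Local Notation vec := {ffun 'I_n -> option Zp}.
Implicit Types (X Y : vec) (f : seq vec -> Zp) (s : seq vec).

Definition nonzero X := [exists i, X i != None].
Definition rotv (g : Zp) X : vec := [ffun i => omap (+%R^~ g) (X i)].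
Definition subvec X Y := [forall i, (X i != None) ==> (Y i == X i)].
Definition supported k X := [forall i, (X i != None) ==> (i <= k)%N].
(** For [X] supported below [k], [extend k X] lies above both [X] and [unitvec k]. These comparisons
    keep the prism and the cone inside the order complex. *)
Definition extend k X : vec := [ffun i : 'I_n => if val i == k then Some 0 else X i].
Definition unitvec k : vec := extend k [ffun=> None].

Lemma subvecP X Y : reflect (forall i, X i != None -> Y i = X i) (subvec X Y).
Proof.
by apply: (iffP forallP) => XY i; [move/(implyP (XY i))/eqP | apply/implyP => /XY/eqP].
Qed.

Lemma nonzero_rot g X : nonzero (rotv g X) = nonzero X.
Proof. by apply: eq_existsb => i; rewrite ffunE; case: (X i). Qed.

Lemma supported_rot k g X : supported k (rotv g X) = supported k X.
Proof. by apply: eq_forallb => i; rewrite ffunE; case: (X i). Qed.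

Lemma subvec_rot g X Y : subvec X Y -> subvec (rotv g X) (rotv g Y).
Proof.
move=> /subvecP XY; apply/subvecP => i; rewrite !ffunE => Xi.
by rewrite XY //; case: (X i) Xi.
Qed.

Lemma rotD g h X : rotv g (rotv h X) = rotv (h + g) X.
Proof. by apply/ffunP => i; rewrite !ffunE; case: (X i) => //= x; rewrite addrA. Qed.

Lemma subvec_extend k X Y : subvec X Y -> subvec (extend k X) (extend k Y).
Proof.
by move=> /subvecP XY; apply/subvecP => i; rewrite !ffunE; case: ifP => // _ /XY.
Qed.

Lemma subvec_extendr k X : supported k X -> subvec X (extend k.+1 X).
Proof.
move=> /forallP Xk; apply/subvecP => i Xi; rewrite ffunE; case: eqP => // ik.
by have := Xk i; rewrite Xi ik ltnn.
Qed.

Lemma subvec_unitvec k X : subvec (unitvec k) (extend k X).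
Proof. by apply/subvecP => i; rewrite !ffunE; case: ifP. Qed.

Lemma nonzero_extend k X : (k < n)%N -> nonzero (extend k X).
Proof. by move=> lt_kn; apply/existsP; exists (Ordinal lt_kn); rewrite ffunE eqxx. Qed.

Lemma supportedS k X : supported k X -> supported k.+1 X.
Proof.
move=> /forallP Xk; apply/forallP => i; apply/implyP => Xi.
by rewrite leqW // (implyP (Xk i)).
Qed.

Lemma supported_extend k X : supported k X -> supported k.+1 (extend k.+1 X).
Proof.
move=> /forallP Xk; apply/forallP => i; rewrite ffunE.
case: ifP => [/eqP->|_]; first exact: leqnn.
by apply/implyP => Xi; rewrite leqW // (implyP (Xk i)).
Qed.

Lemma supported_unitvec k : supported k (unitvec k).
Proof. by apply/forallP => i; rewrite !ffunE; case: ifP => [/eqP->|_]; rewrite ?leqnn. Qed.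

(** The index is both the dimension of the chain and the last coordinate its vectors may use: each
    new coordinate gives room for one more cone. *)
Definition flag k s :=
  [&& size s == k.+1, sorted subvec s, all nonzero s & all (supported k) s].

Lemma flag_rot k g s : flag k s -> flag k (map (rotv g) s).
Proof.
case/and4P => sz_s sub_s nz_s k_s; apply/and4P; split.
- by rewrite size_map.
- by apply: homo_sorted sub_s => X Y; apply: subvec_rot.
- by rewrite all_map (eq_all (nonzero_rot g)).
- by rewrite all_map (eq_all (supported_rot k g)).
Qed.

Lemma sorted_extend k s : sorted subvec s -> sorted subvec (map (extend k) s).
Proof. by apply: homo_sorted => X Y; apply: subvec_extend. Qed.

Lemma all_supported_extend k s :
  all (supported k) s -> all (supported k.+1) (map (extend k.+1) s).
Proof.
by rewrite all_map => /allP k_s; apply/allP => X /k_s; apply: supported_extend.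
Qed.

Lemma flag_cone k s : (k.+1 < n)%N -> flag k s ->
  flag k.+1 (unitvec k.+1 :: map (extend k.+1) s).
Proof.
move=> lt_kn /and4P[sz_s sub_s nz_s k_s]; apply/and4P; split => /=.
- by rewrite size_map.
- have := sorted_extend k.+1 sub_s; case: s {sz_s sub_s nz_s k_s} => //= X s ->.
  by rewrite subvec_unitvec.
- by rewrite nonzero_extend // all_map; apply/allP => X _; apply: nonzero_extend.
- by rewrite supported_unitvec all_supported_extend.
Qed.

Lemma sorted_prism k s i : all (supported k) s -> sorted subvec s ->
  (i < size s)%N ->
  sorted subvec (take i.+1 s ++ map (extend k.+1) (drop i s)).
Proof.
elim: s i => [|X s IHs] [|i] //=.
- rewrite take0 => /andP[Xk _] /= Xs _.
  by rewrite subvec_extendr //=; apply: (@sorted_extend k.+1 (X :: s)).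
- move=> /andP[_ k_s] Xs lt_i.
  have := IHs i k_s (path_sorted Xs) lt_i.
  by case: s {IHs k_s} Xs lt_i => //= Y s /andP[-> _] _ ->.
Qed.

Lemma flag_prism k s i : (k.+1 < n)%N -> flag k s -> (i < size s)%N ->
  flag k.+1 (take i.+1 s ++ map (extend k.+1) (drop i s)).
Proof.
move=> lt_kn /and4P[/eqP sz_s sub_s nz_s k_s] lt_i; apply/and4P; split.
- by rewrite size_cat size_takel // size_map size_drop; apply/eqP; lia.
- exact: sorted_prism.
- rewrite all_cat all_map; apply/andP; split.
    by apply/allP => X /mem_take; apply: (allP nz_s).
  by apply/allP => X _; apply: nonzero_extend.
- rewrite all_cat all_supported_extend ?andbT.
    by apply/allP => X /mem_take /(allP k_s); apply: supportedS.
  by apply/allP => X /mem_drop; apply: (allP k_s).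
Qed.

(** The norm and g - 1 alternate as in the periodic resolution of a cyclic group; consecutive ones
    compose to zero. *)
Definition nu k f s : Zp :=
  if odd k then \sum_g f (map (rotv g) s) else f (map (rotv 1) s) - f s.

(* A chain is represented by the functional it defines on cochains: fundamental
   k.+1 is the cone over nu k applied to fundamental k, so that its boundary is
   nu k (fundamental k). *)
Fixpoint fundamental k f : Zp :=
  if k is k'.+1 then
    fundamental k' (nu k' (cone (unitvec k) (extend k) f))
  else f [:: unitvec 0].

Lemma nu_local k f g s : (forall h, f (map (rotv h) s) = g (map (rotv h) s)) ->
  nu k f s = nu k g s.
Proof.
move=> fg; rewrite /nu; case: odd; first by apply: eq_bigr.
have rot0 : map (rotv 0) s = s.
  rewrite -[RHS]map_id; apply: eq_map => X; apply/ffunP => i; rewrite ffunE.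
  by case: (X i) => //= x; rewrite addr0.
by rewrite fg -{2}rot0 fg rot0.
Qed.

Lemma nuB k f g s : nu k (fun u => f u - g u) s = nu k f s - nu k g s.
Proof. by rewrite /nu; case: odd; [rewrite sumrB | ring]. Qed.

Lemma cobd_nu k f s : cobd (nu k f) s = nu k (cobd f) s.
Proof.
rewrite /nu; case: odd.
  by rewrite cobd_sum; apply: eq_bigr => g _; rewrite cobd_map.
by rewrite cobdB cobd_map.
Qed.

Lemma nu_nu k f s : nu k (nu k.+1 f) s = 0.
Proof.
rewrite /nu /=; case: (odd k) => /=.
  rewrite sumrB; apply/eqP; rewrite subr_eq0; apply/eqP.
  rewrite [RHS](reindex_inj (addIr (1 : Zp))) /=.
  by apply: eq_bigr => g _; rewrite -map_comp; congr f; apply: eq_map => X /=; rewrite rotD.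
apply/eqP; rewrite subr_eq0; apply/eqP.
rewrite [RHS](reindex_inj (addrI (1 : Zp))) /=.
by apply: eq_bigr => g _; rewrite -map_comp; congr f; apply: eq_map => X /=; rewrite rotD.
Qed.

Lemma fundamental_local k f g : (k < n)%N ->
  (forall s, flag k s -> f s = g s) -> fundamental k f = fundamental k g.
Proof.
elim: k f g => [|k IHk] f g lt_kn fg /=.
  by apply: fg; rewrite /flag /= nonzero_extend ?supported_unitvec.
apply: IHk => [|s flag_s]; first exact: ltnW.
apply: nu_local => h; rewrite /cone; congr (_ - _).
  by apply: fg; apply: flag_cone => //; apply: flag_rot.
by apply: prism_local => i lt_i; apply: fg; apply: flag_prism => //; apply: flag_rot.
Qed.

Lemma fundamentalB k f g : (k < n)%N ->
  fundamental k (fun s => f s - g s) = fundamental k f - fundamental k g.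
Proof.
elim: k f g => //= k IHk f g lt_kn; rewrite -IHk 1?ltnW //.
apply: fundamental_local => [|s _]; first exact: ltnW.
rewrite -nuB; apply: nu_local => h; rewrite /cone prismB; ring.
Qed.

Lemma fundamental0 k f : (k < n)%N -> (forall s, flag k s -> f s = 0) ->
  fundamental k f = 0.
Proof.
move=> lt_kn f0; rewrite (@fundamental_local k f (fun s => f s - f s)) //.
  by rewrite fundamentalB // subrr.
by move=> s /f0 ->; rewrite subrr.
Qed.

(** By [cone_homotopy], the two sides differ by the boundary of the previous fundamental chain
    evaluated on a [nu]; by induction this is a composite of two consecutive [nu], hence zero. *)
Lemma boundary_fundamental k f : (k.+1 < n)%N ->
  fundamental k.+1 (cobd f) = fundamental k (nu k f).
Proof.
elim: k f => [|k IHk] f lt_kn.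
  by rewrite /= /nu /= /cone /=; ring.
pose D := @cone vec Zp (unitvec k.+2) (extend k.+2).
rewrite -[LHS]/(fundamental k.+1 (nu k.+1 (D (cobd f)))).
have lt_kn' := ltnW lt_kn.
transitivity (fundamental k.+1 (fun s => nu k.+1 f s - cobd (nu k.+1 (D f)) s)).
  apply: (@fundamental_local k.+1) => // s _; rewrite cobd_nu -nuB; apply: nu_local => h.
  by rewrite -[X in X - _](cone_homotopy (extend k.+2) (unitvec k.+2)) addrC addKr.
rewrite fundamentalB // IHk // [X in _ - X]fundamental0 ?subr0 //; first exact: ltnW.
by move=> s _; rewrite nu_nu.
Qed.

Variables (lam : vec -> Zp).
Hypothesis lam_rot : forall g X, nonzero X -> lam (rotv g X) = lam X + g.

(** Write [theta k.+1] as the coboundary of [psi k], move it to the boundary of the chain, and use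
    [nu_psi] to arrive at [theta k]; in degree 0 the value is 1. *)
Lemma fundamental_theta k : (k < n)%N ->
  fundamental k (fun s => theta k (map lam s)) = 1.
Proof.
elim: k => [|k IHk] lt_kn //; have lt_kn' := ltnW lt_kn.
rewrite -(IHk lt_kn').
transitivity (fundamental k.+1 (cobd (fun s => psi k (map lam s)))).
  apply: fundamental_local => // s /and4P[/eqP sz_s _ _ _].
  by rewrite cobd_map cobd_psi // size_map.
rewrite boundary_fundamental //; apply: fundamental_local => // s.
case/and4P => /eqP sz_s _ nz_s _; rewrite -nu_psi ?size_map // /nu.
have lam_s g : map lam (map (rotv g) s) = [seq x + g | x <- map lam s].
  by rewrite -!map_comp; apply/eq_in_map => X /(allP nz_s) nzX /=; rewrite lam_rot.
by case: odd; rewrite ?lam_s //; apply: eq_bigr => g _; rewrite lam_s.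
Qed.

Lemma tucker_monotone (rk : vec -> nat) m :
    (forall X, nonzero X -> (0 < rk X <= m)%N) ->
    (forall X Y, nonzero X -> subvec X Y -> (rk X <= rk Y)%N) ->
    (forall X Y, nonzero X -> subvec X Y -> rk X = rk Y -> lam X = lam Y) ->
  (n <= m)%N.
Proof.
move=> rk_m rk_le rk_eq; rewrite leqNgt; apply/negP => lt_mn.
have lt_n : (n.-1 < n)%N by case: n lt_mn.
suff th0 s : flag n.-1 s -> theta n.-1 (map lam s) = 0.
  by move/eqP: (fundamental_theta lt_n); rewrite fundamental0 // eq_sym oner_eq0.
move=> /and4P[/eqP sz_s sub_s nz_s _].
rewrite prednK ?(leq_ltn_trans _ lt_mn) // in sz_s.
pose X i := nth [ffun=> None] s i.
have nzX i : (i < n)%N -> nonzero (X i).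
  by move=> lt_i; apply: (allP nz_s); rewrite mem_nth // sz_s.
have subX i : (i.+1 < n)%N -> subvec (X i) (X i.+1).
  by move=> lt_i; apply: (elimT (sortedP [ffun=> None]) sub_s); rewrite sz_s.
have [/existsP[i /andP[lt_i /eqP eq_i]]|] := boolP
    [exists i : 'I_n, (i.+1 < n)%N && (rk (X i) == rk (X i.+1))].
  apply: (@theta_repeat _ _ _ i); first by rewrite size_map sz_s.
  rewrite !(nth_map [ffun=> None]) ?sz_s //.
  by apply: rk_eq => //; [apply: nzX | apply: subX].
rewrite negb_exists => /forallP rk_neq.
(* If ranks strictly increased along the flag, the last of its [n] vectors would have rank above
   [m]. *)
have rkX i : (i < n)%N -> (i < rk (X i))%N.
  elim: i => [|i IHi] lt_i; first by case/andP: (rk_m _ (nzX 0%N lt_i)).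
  have := rk_neq (Ordinal (ltnW lt_i)); rewrite /= lt_i /= => neq_i.
  apply: leq_ltn_trans (IHi (ltnW lt_i)) _.
  by rewrite ltn_neqAle neq_i; apply: rk_le; [apply: nzX; apply: ltnW | apply: subX].
have := rkX _ lt_n; have /andP[_ le_m] := rk_m _ (nzX _ lt_n).
by rewrite ltnNge (leq_trans le_m) // -ltnS prednK // (leq_ltn_trans _ lt_mn).
Qed.

End Tucker.

(** * Equitable families for a prime number of parts *)

Section Families.
Variables (I T : finType).
Implicit Types (F : {set {set T}}) (D : {set T}) (X : {ffun I -> {set T}}).

Definition disjoint_family X :=
  [forall i, forall j, (i != j) ==> [disjoint X i & X j]].

Definition mono_family F (c : {set T} -> nat) (k : nat) D X :=
  disjoint_family X && [forall i, [&& X i \in F, X i \subset D & c (X i) == k]].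

(** The parts may leave some of [D] uncovered; the uncovered points become the deleted set in
    [ecd]. *)
Definition free_family F D X :=
  [&& disjoint_family X, [forall i, forall j, (#|X i| <= #|X j| + 1)%N]
    & [forall i, (X i \subset D) && [forall A in F, ~~ (A \subset X i)]]].

Lemma disjoint_familyP X :
  reflect (forall i j x, x \in X i -> x \in X j -> i = j) (disjoint_family X).
Proof.
apply: (iffP forallP) => [dX i j x xi xj | dX i].
  apply/eqP/negPn/negP => neq_ij; have := implyP (forallP (dX i) j) neq_ij.
  by move/disjointFr => /(_ x xi); rewrite xj.
apply/forallP => j; apply/implyP => neq_ij; rewrite -setI_eq0.
apply/negPn/negP => /set0Pn[x /setIP[xi xj]].
by rewrite (dX i j x xi xj) eqxx in neq_ij.
Qed.
End Families.

(* The set D plays the role of the ground set, so that the statement can be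
   applied to the parts of a partition. *)
Definition equitable_kneser (I : finType) : Prop :=
  forall (T : finType) (F : {set {set T}}) (c : {set T} -> nat) (t : nat)
    (D : {set T}), (forall A, A \in F -> (c A < t)%N) ->
  (exists (k : 'I_t) (A : {ffun I -> {set T}}), mono_family F c k D A) \/
  (exists2 X : {ffun I -> {set T}}, free_family F D X
     & (#|D| <= \sum_i #|X i| + t * #|I|.-1)%N).

Lemma exists_subset_card (T : finType) (A : {set T}) m : (m <= #|A|)%N ->
  exists2 B : {set T}, B \subset A & #|B| = m.
Proof.
move=> le_m; exists [set x in take m (enum A)].
  by apply/subsetP => x; rewrite inE => /mem_take; rewrite mem_enum.
by rewrite cardsE (card_uniqP _) ?take_uniq ?enum_uniq // size_takel // -cardE.
Qed.

Section Prime.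
Variables (p : nat) (p_pr : prime p) (n t : nat).
Variables (F : {set {set 'I_n}}) (c : {set 'I_n} -> nat).
Hypothesis c_lt : forall A, A \in F -> (c A < t)%N.
Local Notation vec := {ffun 'I_n -> option 'F_p}.
Implicit Types (X Y : vec) (g h : 'F_p) (S : {set 'F_p}).

(* An equivariant point of S, well defined since #|S| is invertible mod p when S
   is proper and nonempty. *)
Definition centroid S : 'F_p := (\sum_(x in S) x) / #|S|%:R.

Lemma natFp_neq0 m : (0 < m < p)%N -> m%:R != 0 :> 'F_p.
Proof.
case/andP=> m_gt0 lt_mp; rewrite -(dvdn_pcharf (pchar_Fp p_pr)).
by apply/negP => /(dvdn_leq m_gt0); rewrite leqNgt lt_mp.
Qed.

Lemma centroidD S S' h : (0 < #|S| < p)%N ->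
  (forall g, (g \in S') = (g - h \in S)) -> centroid S' = centroid S + h.
Proof.
move=> S_p S'E; have -> : S' = [set x + h | x in S].
  apply/setP => g; rewrite S'E; apply/idP/imsetP => [gS | [x xS ->]].
    by exists (g - h); rewrite ?subrK.
  by rewrite addrK.
rewrite /centroid card_imset; last exact: addIr.
rewrite big_imset /=; last by move=> x y _ _; apply: addIr.
rewrite big_split /= sumr_const -[h *+ _]mulr_natr mulrDl mulfK //.
exact: natFp_neq0.
Qed.

Definition part X g := [set i | X i == Some g].
Definition small X := [forall g, forall A in F, ~~ (A \subset part X g)].
Definition mu X := #|part X [arg min_(g < 0) #|part X g|]|.
Definition over X := [set g | (mu X < #|part X g|)%N].
(* The largest total size of an equitable family of subsets of the parts of X. *)
Definition level X := (p * mu X + #|over X|)%N.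
Definition hit X k := [set g | [exists A in F, (A \subset part X g) && (c A == k)]].
Definition top X := (\max_(k < t | hit X k != set0) k)%N.
(** When all parts have the same size, [over X] is empty and has no centroid, so the first nonempty
    entry supplies the equivariant choice. *)
Definition label X : 'F_p :=
  if small X then
    if over X == set0 then head 0 (pmap X (enum 'I_n)) else centroid (over X)
  else centroid (hit X (top X)).

Lemma part_rot h X g : part (rotv h X) g = part X (g - h).
Proof.
apply/setP => i; rewrite !inE ffunE; case: (X i) => //= x.
by apply/eqP/eqP => [[<-]|[->]]; rewrite ?addrK ?subrK.
Qed.

Lemma part_subvec X Y g : subvec X Y -> part X g \subset part Y g.
Proof.
move=> /subvecP XY; apply/subsetP => i; rewrite !inE => /eqP Xi.
by rewrite XY Xi.
Qed.

Lemma small_rot h X : small (rotv h X) = small X.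
Proof.
apply/forallP/forallP => sX g; last by rewrite part_rot.
by have := sX (g + h); rewrite part_rot addrK.
Qed.

Lemma small_subvec X Y : subvec X Y -> small Y -> small X.
Proof.
move=> XY /forallP sY; apply/forallP => g; apply/forall_inP => A AF.
apply: contra (forall_inP (sY g) A AF) => /subset_trans; apply.
exact: part_subvec.
Qed.

Lemma mu_le X g : (mu X <= #|part X g|)%N.
Proof. by rewrite /mu; case: arg_minnP => // g0 _; apply. Qed.

Lemma mu_ge X m : (forall g, (m <= #|part X g|)%N) -> (m <= mu X)%N.
Proof. by rewrite /mu. Qed.

Lemma mu_rot h X : mu (rotv h X) = mu X.
Proof.
apply/eqP; rewrite eqn_leq; apply/andP; split; apply: mu_ge => g.
  by have := mu_le (rotv h X) (g + h); rewrite part_rot addrK.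
by rewrite part_rot mu_le.
Qed.

Lemma mu_subvec X Y : subvec X Y -> (mu X <= mu Y)%N.
Proof.
move=> XY; apply: mu_ge => g; apply: leq_trans (mu_le X g) _.
exact/subset_leq_card/part_subvec.
Qed.

Lemma card_over X : (#|over X| < p)%N.
Proof.
rewrite -[X in (_ < X)%N](card_Fp p_pr) -cardsT; apply/proper_card/properP.
split; first exact: subsetT.
by exists [arg min_(g < 0) #|part X g|]; rewrite ?inE // ltnn.
Qed.

Lemma level_gt0 X : nonzero X -> (0 < level X)%N.
Proof.
case/existsP => i; case Xi: (X i) => [g|] // _.
rewrite /level addn_gt0 muln_gt0 prime_gt0 //= !lt0n; case: eqP => //= mu0.
rewrite -lt0n; apply/card_gt0P; exists g; rewrite inE mu0.
by apply/card_gt0P; exists i; rewrite inE Xi.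
Qed.

(** By [card_over], [mu] and [#|over|] are the quotient and remainder of [level] by [p], so levels
    compare lexicographically. *)
Lemma level_subvec X Y : subvec X Y -> (level X <= level Y)%N.
Proof.
move=> XY; have := mu_subvec XY; rewrite leq_eqVlt => /orP[/eqP eq_mu|lt_mu].
  rewrite /level eq_mu leq_add2l; apply/subset_leq_card/subsetP => g.
  rewrite !inE eq_mu => /leq_trans; apply; exact/subset_leq_card/part_subvec.
rewrite /level; apply: leq_trans (leq_addr _ _).
apply: leq_trans (leq_mul (leqnn p) lt_mu).
by rewrite mulnS addnC leq_add2r ltnW // card_over.
Qed.

Lemma level_eq X Y : subvec X Y -> level X = level Y ->
  mu X = mu Y /\ over X = over Y.
Proof.
move=> XY eq_l; have eq_mu : mu X = mu Y.
  have := congr1 (divn^~ p) eq_l; rewrite /level !(mulnC p).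
  by rewrite !divnMDl ?prime_gt0 // !divn_small ?card_over // !addn0.
split=> //; apply/eqP; rewrite eqEcard; apply/andP; split.
  apply/subsetP => g; rewrite !inE eq_mu => /leq_trans; apply.
  exact/subset_leq_card/part_subvec.
by move: eq_l; rewrite /level eq_mu => /addnI->.
Qed.

(** In the balanced case the label depends on the vector itself, so equal rank has to force
    equality: nested parts of the same size coincide. *)
Lemma over0_eq X Y : subvec X Y -> mu X = mu Y -> over X = set0 ->
  over Y = set0 -> X = Y.
Proof.
move=> XY eq_mu X0 Y0.
have muE Z g : over Z = set0 -> #|part Z g| = mu Z.
  move=> Z0; apply/eqP; rewrite eqn_leq mu_le andbT leqNgt.
  by have := in_set0 g; rewrite -Z0 inE => ->.
have partE g : part X g = part Y g.
  by apply/eqP; rewrite eqEcard part_subvec //= !muE // eq_mu.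
apply/ffunP => i; case Yi: (Y i) => [g|].
  have : i \in part Y g by rewrite inE Yi.
  by rewrite -partE inE => /eqP.
by case Xi: (X i) => [g|] //; move/subvecP: XY => /(_ i); rewrite Xi Yi => /(_ isT).
Qed.

Lemma head_rot h X : nonzero X ->
  head 0 (pmap (rotv h X) (enum 'I_n)) = head 0 (pmap X (enum 'I_n)) + h.
Proof.
case/existsP => i Xi; have : i \in enum 'I_n by rewrite mem_enum.
elim: (enum _) => //= j s IHs; rewrite inE ffunE.
by case Xj: (X j) => [g|] //= /predU1P[ij|//]; rewrite ij Xj in Xi.
Qed.

(** Each part is cut down to [mu X] points, with one more kept for the indices in [over X]. *)
Lemma level_free X : small X ->
  exists2 Y : {ffun 'F_p -> {set 'I_n}}, free_family F setT Y
    & (\sum_g #|Y g| = level X)%N.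
Proof.
move=> sX.
have [|Y YP] := @fin_all_exists _ _ (fun g (Y : {set 'I_n}) =>
    Y \subset part X g /\ #|Y| = (mu X + (g \in over X))%N).
  move=> g.
  have [|B BX cB] := @exists_subset_card _ (part X g) (mu X + (g \in over X)).
    by rewrite inE; case: ltnP; rewrite ?addn1 ?addn0 ?mu_le.
  by exists B.
exists (finfun Y); last first.
  under eq_bigr => g _ do rewrite ffunE (YP g).2.
  rewrite big_split /= sum_nat_const card_Fp // -big_mkcond /= sum1_card.
  by [].
apply/and3P; split.
- apply/disjoint_familyP => g h i; rewrite !ffunE.
  move=> /(subsetP (YP g).1) + /(subsetP (YP h).1).
  by rewrite !inE => /eqP -> /eqP[].
- apply/forallP => g; apply/forallP => h; rewrite !ffunE (YP g).2 (YP h).2.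
  by do 2 case: (_ \in _); lia.
- apply/forallP => g; rewrite ffunE subsetT /=; apply/forall_inP => A AF.
  apply: contra (forall_inP (forallP sX g) A AF) => /subset_trans; apply.
  exact: (YP g).1.
Qed.

Lemma hit_rot h X k g : (g \in hit (rotv h X) k) = (g - h \in hit X k).
Proof. by rewrite !inE part_rot. Qed.

Lemma hit_subvec X Y k : subvec X Y -> hit X k \subset hit Y k.
Proof.
move=> XY; apply/subsetP => g; rewrite !inE => /exists_inP[A AF /andP[AX cA]].
by apply/exists_inP; exists A; rewrite // cA (subset_trans AX) ?part_subvec.
Qed.

Lemma top_rot h X : top (rotv h X) = top X.
Proof.
apply: eq_bigl => k; congr (~~ _); apply/eqP/eqP => /setP hX; apply/setP => g.
  by have := hX (g + h); rewrite hit_rot addrK !inE.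
by have := hX (g - h); rewrite -hit_rot !inE.
Qed.

Lemma top_subvec X Y : subvec X Y -> (top X <= top Y)%N.
Proof.
move=> XY; apply/bigmax_leqP => k hk.
apply: (@leq_bigmax_cond _ _ (@nat_of_ord t)).
apply: contraNneq hk => h0; rewrite -subset0 -h0; exact: hit_subvec.
Qed.

Lemma topP X : ~~ small X -> (top X < t)%N /\ hit X (top X) != set0.
Proof.
move=> /forallPn[g /forall_inPn[A AF /negPn AX]].
have hA : hit X (Ordinal (c_lt AF)) != set0.
  by apply/set0Pn; exists g; rewrite inE; apply/exists_inP; exists A; rewrite ?AX /=.
have [|k hk Ek] := @eq_bigmax_cond _ [pred k : 'I_t | hit X k != set0] (@nat_of_ord t).
  by apply/card_gt0P; exists (Ordinal (c_lt AF)).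
by rewrite /top Ek.
Qed.

Hypothesis no_mono : forall (k : 'I_t) (A : {ffun 'F_p -> {set 'I_n}}),
  ~~ mono_family F c k setT A.

Lemma card_hit X k : (k < t)%N -> (#|hit X k| < p)%N.
Proof.
move=> lt_k; rewrite -[X in (_ < X)%N](card_Fp p_pr) ltn_neqAle max_card andbT.
apply/negP => /eqP full.
have hitT g : g \in hit X k.
  have /eqP -> : hit X k == setT by rewrite eqEcard subsetT cardsT full /=.
  by rewrite inE.
have [|A AP] := @fin_all_exists _ _ (fun g (A : {set 'I_n}) =>
    [/\ A \in F, A \subset part X g & c A == k]).
  move=> g; have := hitT g.
  by rewrite inE => /exists_inP[A AF /andP[AX cA]]; exists A.
have /negP := no_mono (Ordinal lt_k) (finfun A); apply; apply/andP; split.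
  apply/disjoint_familyP => g h i; rewrite !ffunE.
  have [_ /subsetP gX _] := AP g; have [_ /subsetP hX _] := AP h.
  by move=> /gX + /hX; rewrite !inE => /eqP -> /eqP[].
by apply/forallP => g; rewrite ffunE subsetT; have [-> _ ->] := AP g.
Qed.

Lemma card_hit_top X : ~~ small X -> (0 < #|hit X (top X)| < p)%N.
Proof. by case/topP => lt_t h0; rewrite card_gt0 h0 card_hit. Qed.

Lemma label_rot h X : nonzero X -> label (rotv h X) = label X + h.
Proof.
move=> nzX; rewrite /label small_rot; case: ifP => [sX | /negbT bX]; last first.
  by rewrite top_rot; apply: centroidD (card_hit_top bX) _ => g; apply: hit_rot.
have overE g : (g \in over (rotv h X)) = (g - h \in over X).
  by rewrite !inE mu_rot part_rot.
have -> : (over (rotv h X) == set0) = (over X == set0).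
  apply/eqP/eqP => /setP oX; apply/setP => g.
    by have := oX (g + h); rewrite overE addrK !inE.
  by have := oX (g - h); rewrite -overE !inE.
case: eqP => [_|/eqP o0]; first exact: head_rot.
by apply: centroidD overE; rewrite card_gt0 o0 card_over.
Qed.

Lemma prime_bound :
  exists2 X : {ffun 'F_p -> {set 'I_n}}, free_family F setT X
    & (n <= \sum_g #|X g| + t * p.-1)%N.
Proof.
have [/exists_inP[X fX le_n]|] := boolP
    [exists X : {ffun 'F_p -> {set 'I_n}} in free_family F setT,
       (n <= \sum_g #|X g| + t * p.-1)%N]; first by exists X.
rewrite negb_exists_in => /forall_inP no_free.
have lt_free X : small X -> (level X + t * p.-1 < n)%N.
  by case/level_free => Y fY <-; rewrite ltnNge no_free.
(* The largest level a small vector can have if the bound fails. Above it remain [t * p.-1] ranks: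
   [p.-1] hit counts for each of [t] colours. *)
pose alpha := (n.-1 - t * p.-1)%N.
pose rank X := if small X then level X else (alpha + top X * p.-1 + #|hit X (top X)|)%N.
have p_gt0 := prime_gt0 p_pr.
(* This makes the truncated subtraction in [alpha] exact. The empty vector is small, since otherwise
   [set0] is in [F] and its copies form a monochromatic disjoint family. *)
have lt_n : (t * p.-1 < n)%N.
  have s0 : small [ffun=> None].
    apply/forallP => g; apply/forall_inP => B BF; apply/negP.
    have -> : part [ffun=> None] g = set0 by apply/setP => i; rewrite !inE ffunE.
    rewrite subset0 => /eqP B0; rewrite {B}B0 in BF.
    have /negP := no_mono (Ordinal (c_lt BF)) [ffun=> set0]; apply; apply/andP; split.
      by apply/disjoint_familyP => i j x; rewrite ffunE inE.
    by apply/forallP => i; rewrite ffunE BF sub0set /=.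
  by apply: leq_trans (lt_free _ s0); rewrite ltnS leq_addl.
have small_le X : small X -> (level X <= alpha)%N.
  by move/lt_free; rewrite /alpha; move: (t * _)%N => b; lia.
suff : (n <= n.-1)%N by have := leq_ltn_trans (leq0n _) lt_n; lia.
apply: (@tucker_monotone _ n label label_rot rank) => [X nzX|X Y nzX XY|X Y nzX XY].
- rewrite /rank; case: ifP => [sX|/negbT bX].
    by rewrite level_gt0 //= (leq_trans (small_le X sX)) ?leq_subr.
  have [lt_t _] := topP bX; have /andP[h_gt0 h_lt] := card_hit_top bX.
  rewrite addn_gt0 h_gt0 orbT /=.
  have : ((top X).+1 * p.-1 <= t * p.-1)%N by rewrite leq_mul2r lt_t orbT.
  move: h_lt lt_n; rewrite mulSn /alpha.
  by move: #|_| (t * _)%N (top X * _)%N => h b e; clear; lia.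
- rewrite /rank; have [sY|bY] := boolP (small Y).
    by rewrite (small_subvec XY sY) level_subvec.
  case: ifP => [sX|/negbT bX].
    by rewrite -addnA (leq_trans (small_le X sX)) // leq_addr.
  rewrite -!addnA leq_add2l.
  have := top_subvec XY; rewrite leq_eqVlt => /orP[/eqP->|lt_top].
    by rewrite leq_add2l subset_leq_card // hit_subvec.
  (* A larger top colour gains at least [p.-1], and [#|hit X (top X)|] is at most [p.-1]. *)
  have /andP[_ h_lt] := card_hit_top bX.
  have : ((top X).+1 * p.-1 <= top Y * p.-1)%N by rewrite leq_mul2r lt_top orbT.
  move: h_lt; rewrite mulSn.
  by move: #|hit X _| #|hit Y _| (top X * _)%N (top Y * _)%N => h h' b e; clear; lia.
rewrite /rank /label; have [sY|bY] := boolP (small Y).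
  rewrite (small_subvec XY sY) => /(level_eq XY)[eq_mu eq_over].
  by rewrite eq_over; case: eqP => // o0; rewrite (over0_eq XY eq_mu) // eq_over.
have /andP[hY_gt0 hY_lt] := card_hit_top bY.
(* A small vector has rank at most [alpha]; a vector that is not small exceeds it, as its hit set is
   nonempty. *)
case: ifP => [sX eq_l|/negbT bX].
  move: (small_le X sX) hY_gt0; rewrite eq_l.
  by move: #|_| (top Y * _)%N => h b; lia.
have /andP[hX_gt0 hX_lt] := card_hit_top bX.
move=> eq_rank; have eq_top : top X = top Y.
  apply/eqP; rewrite eqn_leq top_subvec //= leqNgt; apply/negP => lt_top.
  have : ((top X).+1 * p.-1 <= top Y * p.-1)%N by rewrite leq_mul2r lt_top orbT.
  move: eq_rank hX_lt hY_gt0; rewrite mulSn.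
  by move: #|hit X _| #|hit Y _| (top X * _)%N (top Y * _)%N => h h' b e; lia.
congr centroid; rewrite eq_top; apply/eqP; rewrite eqEcard hit_subvec //=.
by move: eq_rank; rewrite eq_top => /addnI->.
Qed.

End Prime.

Lemma equitable_kneser_prime p : prime p -> equitable_kneser 'F_p.
Proof.
move=> p_pr T F c t D c_lt; pose f : 'I_#|D| -> T := enum_val.
have f_inj : injective f by apply: enum_val_inj.
have fD (B : {set 'I_#|D|}) : f @: B \subset D.
  by apply/subsetP => _ /imsetP[i _ ->]; apply: enum_valP.
pose F' := [set B : {set 'I_#|D|} | f @: B \in F].
pose c' (B : {set 'I_#|D|}) := c (f @: B).
have c'_lt B : B \in F' -> (c' B < t)%N by rewrite inE => /c_lt.
have im_disjoint (A : {ffun 'F_p -> {set 'I_#|D|}}) :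
    disjoint_family A -> disjoint_family [ffun g => f @: A g].
  move=> /disjoint_familyP dA; apply/disjoint_familyP => g h x; rewrite !ffunE.
  by move=> /imsetP[i ig ->] /imsetP[j jh /f_inj ij]; apply: dA ig _; rewrite ij.
have [/existsP[k /existsP[A]]|noA] := boolP
    [exists k : 'I_t, exists A : {ffun 'F_p -> {set 'I_#|D|}}, mono_family F' c' k setT A].
  case/andP => dA /forallP monoA; left; exists k, [ffun g => f @: A g].
  rewrite /mono_family im_disjoint //=; apply/forallP => g; rewrite ffunE fD /=.
  by have := monoA g; rewrite inE subsetT.
have no_mono (k : 'I_t) (A : {ffun 'F_p -> {set 'I_#|D|}}) :
    ~~ mono_family F' c' k setT A.
  by move: noA; rewrite negb_exists => /forallP/(_ k); rewrite negb_exists => /forallP.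
have [X /and3P[dX eX fX] le_D] := prime_bound p_pr c'_lt no_mono.
right; exists [ffun g => f @: X g]; last first.
  by rewrite card_Fp //; under eq_bigr => g _ do rewrite ffunE card_imset //.
apply/and3P; split; first exact: im_disjoint.
  apply/forallP => g; apply/forallP => h; rewrite !ffunE !card_imset //.
  exact: (forallP (forallP eX g)).
apply/forallP => g; rewrite ffunE fD; apply/forall_inP => A AF; apply/negP => AX.
have fA : f @: (f @^-1: A) = A.
  apply/setP => x; apply/imsetP/idP => [[i]|xA]; first by rewrite inE => fi ->.
  by have /imsetP[i _ xi] := subsetP AX x xA; exists i; rewrite // inE -xi.
have /andP[_ /forall_inP/(_ (f @^-1: A))] := forallP fX g.
rewrite inE fA => /(_ AF) /negP; apply; apply/subsetP => i; rewrite inE => /(subsetP AX).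
by rewrite mem_imset.
Qed.

(** * Composite number of parts *)

Lemma equitable_kneser_card (I J : finType) :
  #|I| = #|J| -> equitable_kneser I -> equitable_kneser J.
Proof.
move=> eqIJ kI T F c t D c_lt.
pose phi (j : J) : I := enum_val (cast_ord (esym eqIJ) (enum_rank j)).
have phi_inj : injective phi.
  by move=> i j /enum_val_inj /cast_ord_inj /enum_rank_inj.
have disj (A : {ffun I -> {set T}}) :
    disjoint_family A -> disjoint_family [ffun j => A (phi j)].
  move=> /disjoint_familyP dA; apply/disjoint_familyP => i j x; rewrite !ffunE.
  by move=> xi xj; apply: phi_inj; apply: dA xi xj.
have [[k [A /andP[dA mA]]]|[X /and3P[dX eX fX] le_D]] := kI T F c t D c_lt.
  left; exists k, [ffun j => A (phi j)]; rewrite /mono_family disj //=.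
  by apply/forallP => j; rewrite ffunE (forallP mA).
right; exists [ffun j => X (phi j)].
  apply/and3P; split; first exact: disj.
    by apply/forallP => i; apply/forallP => j; rewrite !ffunE (forallP (forallP eX _)).
  by apply/forallP => j; rewrite ffunE (forallP fX).
have phi_bij : {on [pred i | true], bijective phi}.
  by apply: onW_bij; apply: inj_card_bij phi_inj _; rewrite eqIJ.
under eq_bigr => j _ do rewrite ffunE.
by rewrite -eqIJ; move: le_D; rewrite (reindex phi) //=.
Qed.

(** Removing a point from a largest part preserves equitability, so any smaller total can be reached
    exactly. *)
Lemma free_family_trim (I T : finType) (F : {set {set T}}) D
    (X : {ffun I -> {set T}}) m :
  free_family F D X -> (m <= \sum_i #|X i|)%N ->
  exists2 Y : {ffun I -> {set T}}, free_family F D Y & (\sum_i #|Y i| = m)%N.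
Proof.
move=> fX le_m.
have [d] : exists d, (\sum_i #|X i| = m + d)%N.
  by exists (\sum_i #|X i| - m)%N; rewrite subnKC.
elim: d X fX {le_m} => [|d IHd] X fX sumX; first by exists X; rewrite // sumX addn0.
have [i0 Xi0 | X0] := pickP [pred i | (0 < #|X i|)%N]; last first.
  move: sumX; rewrite big1 ?addnS // => i _.
  by apply/eqP; rewrite -leqn0 leqNgt; have /= -> := X0 i.
have [i max_i] : exists i, forall j, (#|X j| <= #|X i|)%N.
  by case: (@arg_maxnP _ i0 xpredT (fun j => #|X j|)) => // i _ max_i; exists i => j; apply: max_i.
have /card_gt0P[x xi] : (0 < #|X i|)%N := leq_trans Xi0 (max_i i0).
have cXi : #|X i| = #|X i :\ x|.+1 by rewrite (cardsD1 x) xi.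
pose Y := [ffun j => if j == i then X i :\ x else X j].
have YX j : Y j \subset X j by rewrite ffunE; case: eqP => [->|//]; apply: subsetDl.
apply: (IHd Y); last first.
  move: sumX; rewrite (bigD1 i) //= (bigD1 i (F := fun j => #|Y j|)) //= ffunE eqxx cXi.
  under [X in _ -> _ + X = _]eq_bigr => j /negPf ji do rewrite ffunE ji.
  by rewrite addSn addnS => -[].
case/and3P: fX => /disjoint_familyP dX /forallP eX /forallP sX; apply/and3P; split.
- apply/disjoint_familyP => j k y /(subsetP (YX j)) yj /(subsetP (YX k)); exact: dX.
- apply/forallP => j; apply/forallP => k; have := forallP (eX j) k.
  have := max_i j; have := max_i k; rewrite !ffunE cXi.
  case: eqP => [->|_]; case: eqP => [->|_]; rewrite ?cXi; lia.
apply/forallP => j; have /andP[jD /forall_inP jF] := sX j.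
rewrite (subset_trans (YX j) jD); apply/forall_inP => A AF.
by apply: contra (jF A AF) => /subset_trans; apply.
Qed.

Lemma ltn_sum_ex (I : finType) (f g : I -> nat) i :
  (forall j, f j <= g j)%N -> (f i < g i)%N -> (\sum_j f j < \sum_j g j)%N.
Proof.
move=> fg lt_i; rewrite (bigD1 i) // [ltnRHS](bigD1 i) //=.
by rewrite -addSn leq_add // leq_sum.
Qed.

Lemma equitable_kneser_prod (I J : finType) : (0 < #|I|)%N ->
  equitable_kneser I -> equitable_kneser J ->
  equitable_kneser (I * J)%type.
Proof.
move=> I_gt0 kI kJ T F c t D c_lt.
pose hasmono N (k : 'I_t) := [exists A : {ffun I -> {set T}}, mono_family F c k N A].
pose G := [set N | [exists k, hasmono N k]].
pose d N : nat := if [pick k | hasmono N k] is Some k then k else 0%N.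
have dP N : N \in G -> exists2 k : 'I_t, d N = k & hasmono N k.
  rewrite inE /d => /existsP[k0 hk0]; case: pickP => [k hk | /(_ k0)]; first by exists k.
  by rewrite hk0.
have d_lt N : N \in G -> (d N < t)%N by case/dP => k ->.
have [[k [N /andP[/disjoint_familyP dN /forallP monoN]]]|[X fX' le_D]] :=
    kJ T G d t D d_lt.
  left; exists k.
  have [|A AP] := @fin_all_exists _ _ (fun j (A : {ffun I -> {set T}}) =>
      mono_family F c k (N j) A).
    move=> j; have /and3P[NG _ /eqP dk] := monoN j.
    by have [k'] := dP _ NG; rewrite dk => /val_inj <- /existsP[A]; exists A.
  exists [ffun ij => A ij.2 ij.1]; apply/andP; split.
    apply/disjoint_familyP => -[i j] [i' j'] x; rewrite !ffunE /= => xA xA'.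
    have sub l l' : A l l' \subset N l by have /andP[_ /forallP/(_ l')/and3P[]] := AP l.
    have ej : j = j' by apply: (dN j j' x);
      [apply: subsetP (sub j i) x xA | apply: subsetP (sub j' i') x xA'].
    rewrite -ej in xA' *; congr (_, _).
    by have /andP[/disjoint_familyP dA _] := AP j; apply: dA xA xA'.
  apply/forallP => -[i j]; rewrite ffunE /=.
  have /andP[_ /forallP/(_ i)/and3P[-> AN ->]] := AP j.
  by have /and3P[_ ND _] := monoN j; rewrite (subset_trans AN ND).
case/and3P: fX' => /disjoint_familyP dX eX fX.
(* The loss allowed inside each [X j]. As [X j] is not in [G], it contains no monochromatic
   [I]-family, so [kI] yields a free one; trimming makes its total exact. *)
pose e := (t * #|I|.-1)%N.
have [|Y YP] := @fin_all_exists _ _ (fun j (Y : {ffun I -> {set T}}) =>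
    free_family F (X j) Y /\ (\sum_i #|Y i| = #|X j| - e)%N).
  move=> j; have [[k [A mA]]|[Y fY le_Y]] := kI T F c t (X j) c_lt.
    have /andP[_ /forall_inP/(_ (X j))] := forallP fX j.
    rewrite subxx inE => /(_ _)/negP[] //; apply/existsP; exists k.
    by apply/existsP; exists A.
  have [|Z fZ sZ] := @free_family_trim _ _ _ _ _ (#|X j| - e)%N fY.
    by rewrite leq_subLR addnC.
  by exists Z.
right; exists [ffun ij => Y ij.2 ij.1]; last first.
  have -> : (\sum_ij #|[ffun ij => Y ij.2 ij.1] ij| = \sum_j \sum_i #|Y j i|)%N.
    by rewrite exchange_big pair_bigA; apply: eq_bigr => -[i j] _; rewrite ffunE.
  under eq_bigr => j _ do rewrite (YP j).2.
  apply: leq_trans le_D _; rewrite card_prod.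
  have le_X : (\sum_j #|X j| <= \sum_j (#|X j| - e) + #|J| * e)%N.
    rewrite -sum_nat_const -big_split /=; apply: leq_sum => j _.
    by rewrite addnC -leq_subLR leqnn.
  (* The losses add up: t(|J| - 1) + |J| t(|I| - 1) = t(|I||J| - 1). *)
  apply: leq_trans (leq_add le_X (leqnn _)) _; rewrite -addnA leq_add2l /e.
  case: #|I| I_gt0 => // a _; case: #|J| => [|b]; first by rewrite !muln0.
  by rewrite /=; nia.
have YX j i : Y j i \subset X j by have [/and3P[_ _ /forallP/(_ i)/andP[]]] := YP j.
apply/and3P; split.
- apply/disjoint_familyP => -[i j] [i' j'] x; rewrite !ffunE /= => xY xY'.
  have ej : j = j' by apply: (dX j j' x);
    [apply: subsetP (YX j i) x xY | apply: subsetP (YX j' i') x xY'].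
  rewrite -ej in xY' *; congr (_, _).
  by have [/and3P[/disjoint_familyP dY _ _] _] := YP j; apply: dY xY xY'.
- apply/forallP => -[i j]; apply/forallP => -[i' j']; rewrite !ffunE /=.
  have [/and3P[_ /forallP eY _] sY] := YP j.
  have [/and3P[_ /forallP eY' _] sY'] := YP j'.
  rewrite leqNgt; apply/negP => lt_Y.
  (* Averaging: parts from different [j] and [j'] whose sizes differ by two or more would push the
     two totals at least 2 apart, whereas the trimmed totals differ by at most 1. *)
  have lo : (\sum_(l : I) (#|Y j' i'| + 1) < \sum_l #|Y j l|)%N.
    apply: (@ltn_sum_ex _ _ _ i) => // l.
    by have := forallP (eY i) l; lia.
  have hi : (\sum_l #|Y j' l| < \sum_(l : I) (#|Y j' i'| + 1))%N.
    apply: (@ltn_sum_ex _ _ _ i') => [l|]; first exact: (forallP (eY' l) i').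
    by rewrite addn1.
  have := forallP (forallP eX j) j'; rewrite sY in lo; rewrite sY' in hi.
  lia.
apply/forallP => -[i j]; rewrite ffunE /=.
have /andP[XD _] := forallP fX j; rewrite (subset_trans (YX j i) XD) /=.
by have [/and3P[_ _ /forallP/(_ i)/andP[_ ->]] _] := YP j.
Qed.

Lemma equitable_kneser_ord r : (1 < r)%N -> equitable_kneser 'I_r.
Proof.
have [m] := ubnP r; elim: m r => // m IHm r lt_rm r_gt1.
have [r_pr|/primePn[|[d /andP[d_gt1 lt_dr]]]] := boolP (prime r); last 2 first.
- by rewrite ltnNge r_gt1.
- case/dvdnP => e Er; have e_gt1 : (1 < e)%N.
    by move: lt_dr r_gt1; rewrite Er; case: e {Er} => [|[|e]] //; rewrite mul1n ltnn.
  have lt_er : (e < r)%N by rewrite Er ltn_Pmulr // ltnW.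
  apply: (@equitable_kneser_card ('I_e * 'I_d)%type); first by rewrite card_prod !card_ord.
  apply: equitable_kneser_prod; first by rewrite card_ord ltnW.
    by apply: IHm => //; apply: leq_trans lt_er _.
  by apply: IHm => //; apply: leq_trans lt_dr _.
apply: (@equitable_kneser_card 'F_r); first by rewrite card_Fp // card_ord.
exact: equitable_kneser_prime.
Qed.

(** * Almost disjoint sets *)

Lemma ecd_le_chromatic_number (n r s : nat) (F : {set {set 'I_n}}) :
  (1 < r)%N -> (forall A, A \in F -> (s < #|A|)%N) ->
  (ecd r F s./2 <= chromatic_number (KG r F s) * r.-1)%N.
Proof.
move=> r_gt1 F_card; set t := chromatic_number _.
pose V : finType := {A : {set 'I_n} | A \in F}.
have [|/existsP[f /forall_inP f_proper] _] := @chromatic_number_spec _ (KG r F s).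
  by move=> e; rewrite inE => /andP[/eqP->].
have le_half : (s./2 <= s)%N by rewrite -[leqRHS](odd_double_half s) -addnn addnA leq_addl.
(* A shrunken set inherits the colour of one chosen member of [F] from which it arises by deleting
   at most [s./2] points. *)
pose owner (B : {set 'I_n}) : option V :=
    [pick A : V | (B \subset val A) && (#|val A :\: B| <= s./2)%N].
pose G := [set B | owner B].
pose c (B : {set 'I_n}) : nat := if owner B is Some A then f A else 0%N.
have c_lt B : B \in G -> (c B < t)%N by rewrite inE /c; case: (owner B).
have [[k [B /andP[/disjoint_familyP dB /forallP monoB]]]|] :=
    equitable_kneser_ord r_gt1 setT c_lt.
  have [|A AP] := @fin_all_exists _ _ (fun i (A : V) =>
      [/\ B i \subset val A, (#|val A :\: B i| <= s./2)%N & f A = k]).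
    move=> i; have /and3P[] := monoB i; rewrite inE /c /owner.
    case: pickP => // A /andP[BA le_A] _ _ /eqP fA; exists A; split=> //.
    exact: val_inj.
  have small_cap i j : i != j -> (#|val (A i) :&: val (A j)| <= s)%N.
    move=> neq_ij; have [_ Ai _] := AP i; have [_ Aj _] := AP j.
    (* The sets [B i] and [B j] are disjoint, so each common point was deleted from at least one
       owner. *)
    apply: (@leq_trans #|(val (A i) :\: B i) :|: (val (A j) :\: B j)|).
      apply/subset_leq_card/subsetP => x /setIP[xi xj]; rewrite !inE xi xj !andbT.
      by rewrite -negb_and; apply: contra neq_ij => /andP[xBi xBj]; apply/eqP/(dB i j x).
    apply: leq_trans (leq_card_setU _ _) _; apply: leq_trans (leq_add Ai Aj) _.
    by rewrite addnn -[leqRHS](odd_double_half s) leq_addl.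
  (* Equal owners would meet in a whole member of [F], which has more than [s] points. *)
  have A_inj : injective A.
    move=> i j eqA; apply/eqP/negPn/negP => /small_cap; rewrite eqA setIid.
    by rewrite leqNgt F_card // (valP (A j)).
  have : A @: setT \in KG r F s.
    rewrite inE card_imset // cardsT card_ord eqxx; apply/forall_inP => _ /imsetP[i _ ->].
    apply/forall_inP => _ /imsetP[j _ ->]; apply/implyP; rewrite (inj_eq A_inj).
    exact: small_cap.
  move/f_proper/negP; case; apply/forall_inP => _ /imsetP[i _ ->].
  apply/forall_inP => _ /imsetP[j _ ->].
  by have [_ _ ->] := AP i; have [_ _ ->] := AP j.
case=> X /and3P[dX eX /forallP fX]; rewrite cardsT !card_ord => le_n.
have [_ ecd_min] := @ecd_spec n r F s./2 (fun A AF => leq_ltn_trans le_half (F_card A AF)).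
pose U := \bigcup_i X i.
have cardU : #|U| = (\sum_i #|X i|)%N.
  rewrite -sum1_card partition_disjoint_bigcup.
    by apply: eq_bigr => i _; rewrite sum1_card.
  by move=> i j; apply/implyP; apply: (forallP (forallP dX i)).
apply: leq_trans (ecd_min (~: U) _) _; last by rewrite cardsCs setCK card_ord cardU leq_subLR.
apply/existsP; exists X; apply/andP; split; first by apply/and3P; rewrite setCK.
apply/exists_inP=> -[A AF /existsP[i /existsP[E /andP[E_le AE]]]].
(* [A] itself qualifies as an owner of [A :\: E], so this set is in [G] and cannot lie in [X i]. *)
have /andP[_ /forall_inP/(_ (A :\: E))] := fX i.
rewrite AE inE /owner => /(_ _)/negP[] //; case: pickP => // /(_ (exist _ A AF)) /=.
rewrite subsetDl setDDr setDv set0U (leq_trans _ E_le) // subset_leq_card //.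
exact: subsetIr.
Qed.

Local Close Scope ring_scope.
Theorem theorem3 (n r s : nat) (F : {set {set 'I_n}})
  (n_ge1 : 1 <= n) (r_ge2 : 2 <= r)
  (F_nonempty : forall A : {set 'I_n}, A \in F -> A != set0)
  (F_card : forall A : {set 'I_n}, A \in F -> s < #|A|) :
  (Num.ceil ((ecd r F s./2)%:R / (r%:R - 1) : rat)
     <= (chromatic_number (KG r F s))%:Z)%R.
Proof.
rewrite Num.Theory.ceil_le_int.
have -> : (r%:R - 1 = r.-1%:R :> rat)%R by case: r r_ge2 => // r _; rewrite -natr1 addrK.
rewrite ler_pdivrMr; last by rewrite ltr0n -subn1 subn_gt0.
by rewrite -natrM ler_nat ecd_le_chromatic_number.
Qed.
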